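(* Assume $q\ge3$ and let $E$ be an admissible $A$-module scheme over $S$. For $n\ge1$, let $H^n$ denote the kernel of the projection $u:J^nE\to J^{n-1}E$, i.e. the closed $A$-submodule scheme of points with Witt coordinates $(0,\dots,0,y)$, with coordinate $y$. Then there is a unique $A$-linear isomorphism $\vartheta_n:H^n\to\hat{\mathbb G}_a$ of the form $\vartheta_n(y)=y+b_1y^q+b_2y^{q^2}+\cdots$ with $b_i\in\pi^iR$ for all $i\ge1$. Further, the $R$-module $\mathrm{Hom}_A(H^n,\hat{\mathbb G}_a)$ is free with basis $\vartheta_n$.
   Context: Let $q=p^h$, $A=\mathcal O(X\setminus\{\infty\})$ for a projective, geometrically connected, smooth curve $X$ over $\mathbb F_q$ and $\infty\in X(\mathbb F_q)$; $\mathfrak p\subset A$ a maximal ideal, $\hat A$ the $\mathfrak p$-adic completion, $\hat q=|A/\mathfrak p|$, $t\in\mathfrak p\setminus\mathfrak p^2$ with image $\pi\in\hat A$. $R$ is an $\hat A$-algebra which is $\pi$-adically complete and $\pi$-torsion free, with structure map $\theta:A\to R$ and an $\hat A$-algebra endomorphism $\phi$ with $\phi(x)\equiv x^{\hat q}\bmod\pi R$; $S=\mathrm{Spf}R$. $\hat{\mathbb G}_a=\mathrm{Spf}R\langle x\rangle$ with $A$-action $a\mapsto\theta(a)\tau^0$; $R\{\tau\}^\wedge$ = sums $\sum b_i\tau^i$, $b_i\to0$, acting by $x\mapsto\sum b_ix^{q^i}$. An admissible $A$-module scheme is $\hat{\mathbb G}_a$ with a ring map $\varphi_E:A\to R\{\tau\}^\wedge$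 whose $\tau^0$-coefficient at $a$ is $\theta(a)$. Witt vectors: for an $R$-algebra $B$, $B^{\phi^i}$ is $B$ with structure map $R\xrightarrow{\phi^i}R\to B$; $W_n(B)$ is the set $B^{n+1}$ with the unique functorial $R$-algebra structure making the ghost map $w:W_n(B)\to B\times B^\phi\times\cdots\times B^{\phi^n}$, $w_i(x_0,\dots,x_n)=\sum_{k=0}^i\pi^kx_k^{\hat q^{i-k}}$, an $R$-algebra homomorphism. The jet space $J^nE=\mathrm{Spf}R\langle x_0,\dots,x_n\rangle$ has $J^nE(B)=E(W_n(B))=W_n(B)$ (Witt coordinates), with group and $A$-module structure induced from $E$ ($a$ acts by evaluating $\varphi_E(a)$ in the ring $W_n(B)$); $u:J^nE\to J^{n-1}E$ drops the last coordinate. $\mathrm{Hom}_A(-,\hat{\mathbb G}_a)$ denotes homomorphisms of $A$-module formal schemes over $S$. *)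

(* Defs.v *)
From HB Require Import structures.
From mathcomp Require Import all_boot all_order all_algebra.
From mathcomp Require Import boolp classical_sets.

Set Implicit Arguments.
Unset Strict Implicit.
Unset Printing Implicit Defensive.

Import GRing.Theory.
Local Open Scope ring_scope.

(* The curve.  A projective smooth geometrically connected curve X over the   *)
(* finite field F is given by its function field K/F: closed points are the   *)
(* valuation rings of K/F (the local rings of X), and geometric connectedness *)
(* means that F is algebraically closed in K.                                 *)

Section Curve.
Variables (F K : fieldType) (iota : {rmorphism F -> K}).

Definition function_field : Prop :=
  (exists2 x : K, ~ algebraicOver iota x &
     exists s : seq K, forall z : K, exists n d : nat -> {poly F},
       (forall i, d i != 0) /\
       z = \sum_(i < size s)
             (map_poly iota (n i)).[x] / (map_poly iota (d i)).[x] * s`_i) /\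
  (forall z : K, algebraicOver iota z -> exists a : F, z = iota a).

(* Note 0^-1 = 0, so the third clause is harmless at x = 0. *)
Definition place (O : K -> Prop) : Prop :=
  [/\ O 1 /\ (forall x y, O x -> O y -> O (x - y) /\ O (x * y)),
      forall a : F, O (iota a),
      forall x, O x \/ O x^-1
    & exists x, ~ O x].

Definition place_max (O : K -> Prop) (x : K) : Prop :=
  O x /\ (x = 0 \/ ~ O x^-1).

(* an F-rational point: its residue field is F *)
Definition rational_place (O : K -> Prop) : Prop :=
  place O /\ forall x, O x -> exists a : F, place_max O (x - iota a).

(* j identifies A with O(X \ {infty}), the intersection of the local rings at *)
(* the closed points other than infty *)
Definition regular_outside (infty : K -> Prop) (A : comNzRingType)
    (j : {rmorphism A -> K}) : Prop :=
  injective j /\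
  forall z : K, (exists a : A, j a = z) <->
    (forall O, place O -> ~ (forall x, O x <-> infty x) -> O z).

End Curve.

Section Ideals.
Variable A : comNzRingType.

Definition maximal_ideal (P : {pred A}) : Prop :=
  idealr_closed P /\
  forall J : {pred A}, idealr_closed J -> {subset P <= J} -> {subset J <= P}.

Fixpoint ideal_exp (P : {pred A}) (n : nat) (a : A) : Prop :=
  if n is m.+1 then
    exists s : seq (A * A),
      (forall u, u \in s -> u.1 \in P /\ ideal_exp P m u.2) /\
      a = \sum_(u <- s) u.1 * u.2
  else True.

(* |A / P| = n *)
Definition quotient_card (P : {pred A}) (n : nat) : Prop :=
  exists f : A -> 'I_n, (forall i, exists a, f a = i) /\
    (forall a b, f a = f b <-> a - b \in P).

(* c : A -> Ahat exhibits Ahat as the inverse limit of the A / P^n; I n is    *)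
(* the kernel of the projection Ahat -> A / P^n. *)
Definition adic_completion (P : {pred A}) (Ahat : comNzRingType)
    (c : {rmorphism A -> Ahat}) : Prop :=
  exists I : nat -> Ahat -> Prop,
  [/\ forall n, [/\ I n 0, forall x y, I n x -> I n y -> I n (x + y)
                  & forall x y, I n y -> I n (x * y)],
      forall n a, I n (c a) <-> ideal_exp P n a,
      forall n x, exists a, I n (x - c a),
      forall x, (forall n, I n x) -> x = 0
    & forall a : nat -> A, (forall n, ideal_exp P n (a n.+1 - a n)) ->
        exists x, forall n, I n (x - c (a n))].

End Ideals.

Section Adic.
Variables (R : comNzRingType) (pi : R).

(* x \in pi^n R *)
Definition in_piX (n : nat) (x : R) : Prop := exists y, x = pi ^+ n * y.

Definition adically_complete : Prop :=
  (forall x, (forall n, in_piX n x) -> x = 0) /\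
  (forall u : nat -> R, (forall n, in_piX n (u n.+1 - u n)) ->
     exists l, forall n, in_piX n (l - u n)).

Definition torsion_free : Prop := forall x, pi * x = 0 -> x = 0.

(* b_i -> 0 in the pi-adic topology.  The restricted power series ring R<x>   *)
(* and the module underlying R{tau}^ both consist of such sequences. *)
Definition null_seq (b : nat -> R) : Prop :=
  forall n, exists N, forall i, (N <= i)%N -> in_piX n (b i).

(* the R-algebras over which pi-adic formal schemes over Spf R are tested *)
Definition nilp (B : comAlgType R) : Prop := exists N, pi ^+ N *: (1 : B) = 0.

End Adic.

(* The sum of the u_i when u is eventually zero (junk value otherwise).       *)
(* All sums below over pi-nilpotent algebras are of this kind. *)
Definition fin_sum (C : zmodType) (u : nat -> C) : C :=
  xget 0 [set s | exists N, forall m, (N <= m)%N -> \sum_(i < m) u i = s]%classic.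

Definition series_eval (R : comNzRingType) (f : nat -> R) (C : comAlgType R)
  (x : C) : C := fin_sum (fun i => f i *: x ^+ i).

Definition tau_eval (q : nat) (R : comNzRingType) (b : nat -> R)
  (C : comAlgType R) (x : C) : C := fin_sum (fun i => b i *: x ^+ (q ^ i)).

(* ring maps A -> R{tau}^ with constant coefficient theta; in R{tau}^ one has *)
(* tau b = b^q tau *)
Record admissible (q : nat) (A R : comNzRingType) (pi : R) (theta : A -> R) :=
  Admissible {
    adm_coef :> A -> nat -> R;
    adm_null : forall a, null_seq pi (adm_coef a);
    adm_one : forall k, adm_coef 1 k = (k == 0)%N%:R;
    adm_add : forall a b k, adm_coef (a + b) k = adm_coef a k + adm_coef b k;
    adm_mul : forall a b k, adm_coef (a * b) k =
      \sum_(i < k.+1) adm_coef a i * adm_coef b (k - i)%N ^+ (q ^ i);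
    adm_tau0 : forall a, adm_coef a 0%N = theta a
  }.

Section Witt.
Variables (R : comNzRingType) (pi : R) (qh : nat) (phi : R -> R).

Definition ghost (B : comAlgType R) (n : nat) (x : {ffun 'I_n.+1 -> B})
    (i : 'I_n.+1) : B :=
  \sum_(k < n.+1 | (k <= i)%N) pi ^+ k *: x k ^+ (qh ^ (i - k)).

(* Functorial R-algebra structures on the sets B^(n+1) (identified with       *)
(* witt n B through coord) for which the ghost map to B x B^phi x ... is a    *)
(* homomorphism of R-algebras.  When R is pi-torsion free of characteristic   *)
(* p, qh is a power of p, and phi is a ring endomorphism fixing pi and        *)
(* lifting the qh-power map mod pi, there is exactly one such structure.      *)
Record wittFunctor := WittFunctor {
  witt : nat -> comAlgType R -> comAlgType R;
  coord : forall n (B : comAlgType R), witt n B -> {ffun 'I_n.+1 -> B};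
  of_coord : forall n (B : comAlgType R), {ffun 'I_n.+1 -> B} -> witt n B;
  coordK : forall n (B : comAlgType R), cancel (@coord n B) (@of_coord n B);
  of_coordK : forall n (B : comAlgType R), cancel (@of_coord n B) (@coord n B);
  witt_map : forall n (B C : comAlgType R) (f : {lrmorphism B -> C}),
    exists g : {lrmorphism witt n B -> witt n C},
      forall x i, coord (g x) i = f (coord x i);
  ghost1 : forall n (B : comAlgType R) i, ghost (coord (1 : witt n B)) i = 1;
  ghostD : forall n (B : comAlgType R) (x y : witt n B) i,
    ghost (coord (x + y)) i = ghost (coord x) i + ghost (coord y) i;
  ghostM : forall n (B : comAlgType R) (x y : witt n B) i,
    ghost (coord (x * y)) i = ghost (coord x) i * ghost (coord y) i;
  ghostZ : forall n (B : comAlgType R) (r : R) (x : witt n B) i,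
    ghost (coord (r *: x)) i = iter i phi r *: ghost (coord x) i
}.

End Witt.

(* A-module formal schemes over Spf R with underlying formal scheme Spf R<y>, *)
(* by their functor of points: M(B) = {x : amb B | pts x} with the addition   *)
(* of amb B and the action act, and crd : M(B) ~ B is the coordinate y. *)
Record amodScheme (A R : comNzRingType) := AModScheme {
  amb : comAlgType R -> zmodType;
  pts : forall B : comAlgType R, amb B -> Prop;
  act : forall B : comAlgType R, A -> amb B -> amb B;
  crd : forall B : comAlgType R, amb B -> B
}.

Section Hom.
Variables (A R : comNzRingType) (pi : R).
Implicit Types M N : amodScheme A R.

(* A morphism Spf R<y> -> Spf R<x> is the series f in R<y> which is the image *)
(* of x; it sends the point with coordinate y to the one with coordinate f(y). *)
Definition maps_to M N (f : nat -> R) (B : comAlgType R) (x : amb M B)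
    (z : amb N B) : Prop :=
  [/\ pts x, pts z & crd z = series_eval f (crd x)].

(* Hom_A(M, N) *)
Definition homA M N (f : nat -> R) : Prop :=
  null_seq pi f /\
  forall B : comAlgType R, nilp pi B ->
    (forall (x x' : amb M B) (z z' : amb N B),
       maps_to f x z -> maps_to f x' z' -> maps_to f (x + x') (z + z')) /\
    (forall (a : A) (x : amb M B) (z : amb N B),
       maps_to f x z -> maps_to f (act a x) (act a z)).

Definition isoA M N (f : nat -> R) : Prop :=
  homA M N f /\
  exists2 g : nat -> R, homA N M g &
    forall B : comAlgType R, nilp pi B -> forall y : B,
      series_eval g (series_eval f y) = y /\
      series_eval f (series_eval g y) = y.

End Hom.

Definition Ga (A R : comNzRingType) (theta : A -> R) : amodScheme A R :=
  {| amb := fun B => B;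
     pts := fun B _ => True;
     act := fun B a x => theta a *: x;
     crd := fun _ x => x |}.

Section Jet.
Variables (q : nat) (A R : comNzRingType) (pi : R) (theta : A -> R).
Variables (qh : nat) (phi : R -> R) (W : wittFunctor pi qh phi).
Variable E : admissible q pi theta.

(* (J^n E)(B) = E(W_n(B)) = W_n(B) *)
Definition jet_act (n : nat) (B : comAlgType R) (a : A) (x : witt W n B) :
  witt W n B := tau_eval q (E a) x.

(* u : J^(n+1) E -> J^n E *)
Definition jet_proj (n : nat) (B : comAlgType R) (x : witt W n.+1 B) :
    witt W n B :=
  of_coord W [ffun i => coord x (widen_ord (leqnSn n.+1) i)].

(* H^(n+1), the kernel of u : J^(n+1) E -> J^n E *)
Definition jet_ker (n : nat) : amodScheme A R :=
  {| amb := fun B => witt W n.+1 B;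
     pts := fun B x => jet_proj x = 0;
     act := fun B a x => jet_act a x;
     crd := fun B x => coord x ord_max |}.

End Jet.

(* f = y + b_1 y^q + b_2 y^(q^2) + ... with b_i \in pi^i R *)
Definition theta_form (q : nat) (R : comNzRingType) (pi : R) (f : nat -> R) :
    Prop :=
  exists b : nat -> R,
  [/\ b 0%N = 1,
      forall i, (0 < i)%N -> in_piX pi i (b i),
      forall i, f (q ^ i)%N = b i
    & forall m, (forall i, m != q ^ i)%N -> f m = 0].

(* M is an R-submodule of R<y>, free with basis the single element e *)
Definition free_with_basis (R : comNzRingType) (M : (nat -> R) -> Prop)
    (e : nat -> R) : Prop :=
  [/\ M (fun=> 0),
      forall (r : R) (f g : nat -> R),
        M f -> M g -> M (fun m => r * f m + g m),
      M e
    & forall f, M f -> exists! r : R, forall m, f m = r * e m].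

(* the composite A -> Ahat -> R *)
Definition struct_map (A Ahat : comNzRingType) (c : {rmorphism A -> Ahat})
  (R : comAlgType Ahat) (a : A) : R := (c a)%:A.
Arguments struct_map {A Ahat} c R a.

(* Main.v *)
(* On V(y) = (0, ..., 0, y), with y in position N = n + 1, ghost components   *)
(* (checked over the torsion-free ring R[X, Y] and specialised) show that     *)
(* H^N has additive coordinate y, on which a acts by                          *)
(*   psi(a) = sum_i phi^N(E(a)_i) pi^(N (q^i - 1)) tau^i.                     *)
(* If f commutes with the actions of t, then f(psi(t) y) = pi f(y), where     *)
(* psi(t) = pi y + ...; comparing coefficients of y^m and using that          *)
(* 1 - pi^(m-1) is regular, f is determined by its linear coefficient.        *)
(* Conversely sum_i b_i tau^i commutes with t iff                             *)
(*   b_k (pi - pi^(q^k)) = sum_(i < k) b_i psi(t)_(k-i)^(q^i),                *)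
(* which is solved recursively in pi^k R when q >= 3.  The solution vartheta  *)
(* is A-linear because vartheta psi(a) and theta(a) vartheta both commute     *)
(* with t and have the same linear coefficient. *)
Require Import Defs.
From HB Require Import structures.
From mathcomp Require Import all_boot all_order all_algebra.
From mathcomp Require Import boolp classical_sets.
From mathcomp Require Import finfield abelian pgroup.

Set Implicit Arguments.
Unset Strict Implicit.
Unset Printing Implicit Defensive.

Import GRing.Theory.
Local Open Scope ring_scope.

(* Unqualified, these would be the notions of [vector] and [seq]. *)
Local Notation coord := Defs.coord.
Local Notation nilp := Defs.nilp.

(** Write N = n + 1. A point of H^N is V(y) = (0, ..., 0, y), and its ghost vector is (0, ..., 0,
    pi^N y). Formally, a therefore acts on y by psi(a) = pi^(-N) E'(a) pi^N, where E'(a) is E(a)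
    with phi^N applied to its coefficients; this is integral, and its tau^i coefficient is divisible
    by pi^(N (q^i - 1)) ([jet_act_ver], [ker_coefM]).

    Linearity for t alone is already rigid: testing on (R / pi^(k+1))[X] shows that a series
    commuting with the action of t is determined by its linear coefficient ([series_eq0],
    [t_linear_unique]). Uniqueness follows, and so does freeness, because f and f_1 vartheta must
    agree. For existence, [tau_log_exists] solves the commutation with t recursively,
    [tau_log_linear] passes from t to all of A by rigidity, and [tau_inverse] inverts the solution,
    whose leading coefficient is 1. *)

(** * Algebras obtained by restriction of scalars *)

(** An alias of S that remembers f, so that the R-algebra structure through f can be attached to it.
    It serves for R[X, Y] and for (R / pi^(k+1))[X]. *)
Definition restr_scalars (R S : comNzRingType) (f : {rmorphism R -> S}) : Type :=
  S.

Section RestrictionOfScalars.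
Variables (R S : comNzRingType) (f : {rmorphism R -> S}).

HB.instance Definition _ := GRing.ComNzRing.copy (restr_scalars f) S.

Let scale (r : R) (s : restr_scalars f) : restr_scalars f := f r * s.

Fact restr_scaleA a b v : scale a (scale b v) = scale (a * b) v.
Proof. by rewrite /scale rmorphM mulrA. Qed.
Fact restr_scale1 : left_id 1 scale.
Proof. by move=> v; rewrite /scale rmorph1 mul1r. Qed.
Fact restr_scaleDr : right_distributive scale +%R.
Proof. by move=> a u v; rewrite /scale mulrDr. Qed.
Fact restr_scaleDl v : {morph scale^~ v : a b / a + b}.
Proof. by move=> a b; rewrite /scale rmorphD mulrDl. Qed.

HB.instance Definition _ := GRing.Zmodule_isLmodule.Build R (restr_scalars f)
  restr_scaleA restr_scale1 restr_scaleDr restr_scaleDl.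

Fact restr_scaleAl (a : R) (u v : restr_scalars f) : a *: (u * v) = a *: u * v.
Proof. exact: mulrA. Qed.

HB.instance Definition _ :=
  GRing.Lmodule_isLalgebra.Build R (restr_scalars f) restr_scaleAl.
HB.instance Definition _ :=
  GRing.Lalgebra_isComAlgebra.Build R (restr_scalars f).

Lemma restr_scaleE (a : R) (u : restr_scalars f) : a *: u = (f a * u : S).
Proof. by []. Qed.

End RestrictionOfScalars.

(** * The generic pair of elements of an R-algebra *)

Definition alg_torsion_free (R : comNzRingType) (pi : R) (B : comAlgType R) :=
  forall x : B, pi *: x = 0 -> x = 0.

Section Bivariate.
Variable R : comNzRingType.

Definition bipoly : comAlgType R :=
  restr_scalars (polyC \o @polyC R : {rmorphism R -> {poly {poly R}}}).

Definition biX : bipoly := 'X%:P : {poly {poly R}}.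
Definition biY : bipoly := 'X : {poly {poly R}}.

Lemma bipoly_torsion_free (pi : R) :
  torsion_free pi -> alg_torsion_free pi bipoly.
Proof.
move=> htf x; rewrite restr_scaleE /= mul_polyC => /polyP x0.
apply/polyP => i; move: (x0 i); rewrite coefZ coef0 mul_polyC => /polyP xi0.
by apply/polyP => k; move: (xi0 k); rewrite coefZ !coef0 => /htf.
Qed.

(** R[X, Y] is the free commutative R-algebra on two generators; the evaluation is done first in X
    on coefficients, then in Y. *)
Lemma bipoly_eval (B : comAlgType R) (x y : B) :
  exists g : {lrmorphism bipoly -> B}, g biX = x /\ g biY = y.
Proof.
pose cxy : commr_rmorph (horner_alg x) y := fun p => mulrC y (horner_alg x p).
pose ev : {rmorphism {poly {poly R}} -> B} := horner_morph cxy.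
pose g (p : bipoly) : B := ev p.
have gM : monoid_morphism g.
  by split=> [|a b]; [exact: (rmorph1 ev) | exact: (rmorphM ev)].
have gA : zmod_morphism g by move=> a b; exact: (rmorphB ev).
have gZ : scalable g.
  move=> r a; transitivity (r%:A * g a); last exact: mulr_algl.
  rewrite -(horner_algC x r) -(horner_morphC cxy).
  exact: (rmorphM ev r%:P%:P a).
pose gm := GRing.isMonoidMorphism.Build _ _ g gM.
pose ga := GRing.isZmodMorphism.Build _ _ g gA.
pose gz := GRing.isScalable.Build _ _ _ _ g gZ.
pose G : {lrmorphism bipoly -> B} := HB.pack g gm ga gz.
exists G; split; last exact: (horner_morphX cxy).
by rewrite -[RHS](horner_algX x); exact: (horner_morphC cxy).
Qed.

End Bivariate.

(** * Arithmetic of the Witt vectors (0, ..., 0, y) *)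

Section WittKernel.
Variables (R : comNzRingType) (pi : R) (qh : nat) (phi : {rmorphism R -> R}).
Hypotheses (htf : torsion_free pi) (hqh : (0 < qh)%N).
Variable W : wittFunctor pi qh phi.
Variable n : nat.
Implicit Types B : comAlgType R.

Lemma alg_torsion_freeX B m (x : B) :
  alg_torsion_free pi B -> pi ^+ m *: x = 0 -> x = 0.
Proof.
move=> hB; elim: m => [|m IH]; first by rewrite expr0 scale1r.
by rewrite exprS -scalerA => /hB /IH.
Qed.

(** The ghost map is triangular: component i is pi^i x_i plus terms in earlier coordinates, and pi^i
    can be cancelled. *)
Lemma ghost_inj m B (x y : {ffun 'I_m.+1 -> B}) : alg_torsion_free pi B ->
  (forall i, ghost pi qh x i = ghost pi qh y i) -> x = y.
Proof.
move=> hB hxy; apply/ffunP => -[i lti].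
elim/ltn_ind: i lti => i IH lti.
have := hxy (Ordinal lti); rewrite /ghost.
rewrite (bigD1 (Ordinal lti)) //= [in RHS](bigD1 (Ordinal lti)) //=.
rewrite subnn !expr1.
set u := \sum_(_ < _ | _) _; set v := \sum_(_ < _ | _) _.
have -> : u = v.
  apply: eq_bigr => -[k ltk] /andP[/= leki neki]; rewrite IH //.
  by rewrite ltn_neqAle leki andbT.
move/addIr/eqP; rewrite -subr_eq0 -scalerBr => /eqP /(alg_torsion_freeX hB).
by move/eqP; rewrite subr_eq0 => /eqP.
Qed.

Lemma witt_inj m B (x y : witt W m B) : coord x = coord y -> x = y.
Proof. by move=> h; rewrite -(coordK x) -(coordK y) h. Qed.

Lemma witt0_tf m B : alg_torsion_free pi B ->
  coord (0 : witt W m B) = [ffun=> 0].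
Proof.
move=> hB; apply: ghost_inj => // i; transitivity (0 : B).
  have := ghostD (0 : witt W m B) 0 i; rewrite addr0 => /eqP.
  by rewrite -subr_eq subrr => /eqP.
rewrite /ghost big1 // => k _; rewrite ffunE expr0n.
by rewrite expn_eq0 (gtn_eqF hqh) /= scaler0.
Qed.

(** Ghost components determine a vector only over a torsion-free algebra, so the claim is carried
    from R[X, Y] to B by functoriality. *)
Lemma coord_witt0 m B i : coord (0 : witt W m B) i = 0.
Proof.
have [f [_ _]] := bipoly_eval (0 : B) 0.
have [g hg] := witt_map W m f.
rewrite -(raddf0 g) hg witt0_tf; last exact: bipoly_torsion_free.
by rewrite ffunE raddf0.
Qed.

(** The iterated Verschiebung V^(n+1) from B = W_0(B) to W_(n+1)(B). *)
Definition ver B (y : B) : witt W n.+1 B :=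
  of_coord W [ffun i => if i == ord_max then y else 0].

Lemma coord_ver B (y : B) i :
  coord (ver y) i = if i == ord_max then y else 0.
Proof. by rewrite of_coordK ffunE. Qed.

Lemma coord_ver_max B (y : B) : coord (ver y) ord_max = y.
Proof. by rewrite coord_ver eqxx. Qed.

Lemma ghost_ver B (y : B) i : ghost pi qh (coord (ver y)) i =
  if i == ord_max then pi ^+ n.+1 *: y else 0.
Proof.
rewrite /ghost; have [->|ni] := eqVneq.
  rewrite (bigD1 ord_max) //= coord_ver_max subnn expr1 big1 ?addr0 // => k.
  move=> /andP[_ /negPf nk]; rewrite coord_ver nk expr0n.
  by rewrite expn_eq0 (gtn_eqF hqh) /= scaler0.
rewrite big1 // => k leki; rewrite coord_ver ifF; last first.
  apply: contraNF ni => /eqP ek; rewrite -val_eqE eqn_leq -ltnS ltn_ord /=.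
  by rewrite ek in leki.
by rewrite expr0n expn_eq0 (gtn_eqF hqh) /= scaler0.
Qed.

Lemma ver_map B (C : comAlgType R) (f : {lrmorphism B -> C}) :
  exists g : {lrmorphism witt W n.+1 B -> witt W n.+1 C},
    forall y, g (ver y) = ver (f y).
Proof.
have [g hg] := witt_map W n.+1 f; exists g => y.
apply/witt_inj/ffunP => i; rewrite hg !coord_ver.
by case: ifP => // _; rewrite raddf0.
Qed.

(* Identities between polynomial expressions in two elements can be checked *)
(* on R[X, Y], which is torsion free, hence on ghost components. *)
Lemma ver_add B (y z : B) : ver y + ver z = ver (y + z).
Proof.
have [f [<- <-]] := bipoly_eval y z; have [g hg] := ver_map f.
rewrite -raddfD -!hg -raddfD; congr (g _).
apply/witt_inj/ghost_inj; first exact: bipoly_torsion_free.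
move=> i; rewrite ghostD !ghost_ver; case: ifP; rewrite ?addr0 // => _.
by rewrite scalerDr.
Qed.

(** On the only nonzero ghost component this is (pi^(n+1) y) (pi^(n+1) z) = pi^(n+1) (pi^(n+1) y
    z). *)
Lemma ver_mul B (y z : B) : ver y * ver z = ver (pi ^+ n.+1 *: (y * z)).
Proof.
have [f [<- <-]] := bipoly_eval y z; have [g hg] := ver_map f.
rewrite -rmorphM -linearZ -!hg -rmorphM; congr (g _).
apply/witt_inj/ghost_inj; first exact: bipoly_torsion_free.
move=> i; rewrite ghostM !ghost_ver; case: ifP; rewrite ?mulr0 // => _.
by rewrite -scalerAl -scalerAr.
Qed.

Hypothesis phi_pi : phi pi = pi.

(** R acts on the last ghost component through phi^(n+1). *)
Lemma ver_scale B (r : R) (y : B) : r *: ver y = ver (iter n.+1 phi r *: y).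
Proof.
have [f [<- _]] := bipoly_eval y y; have [g hg] := ver_map f.
rewrite -linearZ -!hg -linearZ; congr (g _).
apply/witt_inj/ghost_inj; first exact: bipoly_torsion_free.
move=> i; rewrite ghostZ !ghost_ver; case: eqP => [->|_]; rewrite ?scaler0 //=.
by rewrite !scalerA mulrC.
Qed.

Lemma ver_exp B (y : B) m :
  ver y ^+ m.+1 = ver (pi ^+ (n.+1 * m) *: y ^+ m.+1).
Proof.
elim: m => [|m IH]; first by rewrite muln0 expr0 scale1r !expr1.
rewrite exprS IH ver_mul -scalerAr scalerA -exprD -exprS.
by rewrite mulnS.
Qed.

Lemma ver0 B : ver (0 : B) = 0.
Proof.
by apply/witt_inj/ffunP => i; rewrite coord_ver coord_witt0; case: ifP.
Qed.

Lemma jet_ker_pts B (x : witt W n.+1 B) :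
  jet_proj x = 0 <-> x = ver (coord x ord_max).
Proof.
have coordP i : coord (jet_proj x) i = coord x (widen_ord (leqnSn n.+1) i).
  by rewrite of_coordK ffunE.
split=> [x0|->]; last first.
  apply/witt_inj/ffunP => i; rewrite of_coordK ffunE coord_ver coord_witt0.
  by rewrite -val_eqE /= ltn_eqF.
apply/witt_inj/ffunP => i; rewrite coord_ver; case: eqP => [->//|/eqP ni].
have lti : (i < n.+1)%N by rewrite ltn_neqAle -ltnS ltn_ord andbT.
have := coordP (Ordinal lti); rewrite x0 coord_witt0 => ->.
by congr (coord x _); apply/val_inj.
Qed.

End WittKernel.

(** * Eventually zero sums and course-of-values recursion *)

Lemma sum_truncate (C : zmodType) (u : nat -> C) M m : (M <= m)%N ->
  (forall i, (M <= i)%N -> u i = 0) -> \sum_(i < m) u i = \sum_(i < M) u i.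
Proof.
move=> leMm u0; rewrite -(subnKC leMm) big_split_ord /= [X in _ + X]big1 ?addr0 //.
by move=> i _; rewrite u0 ?leq_addr.
Qed.

Lemma fin_sumE (C : zmodType) (u : nat -> C) M :
  (forall i, (M <= i)%N -> u i = 0) -> fin_sum u = \sum_(i < M) u i.
Proof.
move=> u0; apply: xget_unique => [|s [N hN]].
  by exists M => m leMm; exact: sum_truncate.
by rewrite -(hN (maxn M N)) ?leq_maxr // (sum_truncate _ u0) ?leq_maxl.
Qed.

Lemma strong_rec (T : Type) (x0 : T) (G : nat -> (nat -> T) -> T) :
  (forall k f g, (forall i, (i < k)%N -> f i = g i) -> G k f = G k g) ->
  exists b, forall k, b k = G k b.
Proof.
(* [h n] is an approximation with the right values at all indices below n; [x0] only fills the
   start. *)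
move=> Gext; pose h := fix h n := if n is m.+1 then G^~ (h m) else fun=> x0.
have hst k n m : (k < n)%N -> (k < m)%N -> h n k = h m k.
  elim/ltn_ind: k n m => k IH [//|n] [//|m] ltkn ltkm /=.
  by apply: Gext => i ltik; apply: IH => //; exact: leq_trans ltik _.
exists (fun k => h k.+1 k) => k; apply: Gext => i ltik; exact: hst.
Qed.

(** * Divisibility by powers of pi, and evaluation of restricted series *)

Section Adic.
Variables (R : comNzRingType) (pi : R).
Hypotheses (hcomp : adically_complete pi) (htf : torsion_free pi).

Lemma in_piX0 n : in_piX pi n 0.
Proof. by exists 0; rewrite mulr0. Qed.

Lemma in_piXX n : in_piX pi n (pi ^+ n).
Proof. by exists 1; rewrite mulr1. Qed.

Lemma in_piXD n x y : in_piX pi n x -> in_piX pi n y -> in_piX pi n (x + y).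
Proof. by move=> [a ->] [b ->]; exists (a + b); rewrite mulrDr. Qed.

Lemma in_piXM m n x y : in_piX pi m x -> in_piX pi n y -> in_piX pi (m + n) (x * y).
Proof. by move=> [a ->] [b ->]; exists (a * b); rewrite exprD mulrACA. Qed.

Lemma in_piXl n x y : in_piX pi n x -> in_piX pi n (y * x).
Proof. by move=> [a ->]; exists (y * a); rewrite mulrCA. Qed.

Lemma in_piXr n x y : in_piX pi n x -> in_piX pi n (x * y).
Proof. by rewrite mulrC; exact: in_piXl. Qed.

Lemma in_piX_leq m n x : (m <= n)%N -> in_piX pi n x -> in_piX pi m x.
Proof.
by move=> lemn [a ->]; exists (pi ^+ (n - m) * a); rewrite mulrA -exprD subnKC.
Qed.

Lemma in_piX_exp n x m : in_piX pi n x -> in_piX pi (n * m) (x ^+ m).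
Proof. by move=> [a ->]; exists (a ^+ m); rewrite exprMn exprM. Qed.

Lemma in_piX_sum n k (u : nat -> R) :
  (forall i, (i < k)%N -> in_piX pi n (u i)) -> in_piX pi n (\sum_(i < k) u i).
Proof.
move=> hu; elim/big_ind: _ => [||i _]; [exact: in_piX0| exact: in_piXD |exact: hu].
Qed.

(** Iterating gives x = pi^(m n) x for all n, so separatedness applies. In other words 1 - pi^m is
    regular. *)
Lemma piX_fixed m x : (0 < m)%N -> x = pi ^+ m * x -> x = 0.
Proof.
move=> m0 hx; apply: hcomp.1 => n; apply: (@in_piX_leq _ (m * n)).
  by rewrite leq_pmull.
exists x; elim: n => [|n IH]; first by rewrite muln0 mul1r.
by rewrite mulnS exprD -mulrA -IH.
Qed.

(** The inverse is the limit of the geometric sums u_n, which satisfy (1 - pi^m) u_n = 1 - pi^(m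
    n). *)
Lemma one_sub_piX_inv m : (0 < m)%N -> exists l, l * (1 - pi ^+ m) = 1.
Proof.
move=> m0; pose u n := \sum_(i < n) (pi ^+ m) ^+ i.
have [|l hl] := hcomp.2 u.
  move=> n; rewrite /u big_ord_recr /= addrAC subrr add0r -exprM.
  by apply: (@in_piX_leq _ (m * n)); [rewrite leq_pmull | exact: in_piXX].
exists l; apply/eqP; rewrite -subr_eq0; apply/eqP/hcomp.1 => n.
have -> : l * (1 - pi ^+ m) - 1 = (l - u n) * (1 - pi ^+ m) - pi ^+ (m * n).
  have uE : (1 - pi ^+ m) * u n = 1 - pi ^+ (m * n).
    by rewrite -opprB mulNr -subrX1 opprB exprM.
  by rewrite mulrBl [u n * _]mulrC uE opprB addrA addrAC addrK.
apply: in_piXD; first exact/in_piXr.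
rewrite -mulN1r; apply/in_piXl/(@in_piX_leq _ (m * n)).
  by rewrite leq_pmull.
exact: in_piXX.
Qed.

Lemma piX_proper k : ~ in_piX pi k.+1 1.
Proof.
move=> [y hy]; have /eqP := oner_neq0 R; apply; apply: hcomp.1 => n.
have : in_piX pi (k.+1 * n) (1 ^+ n) by apply: in_piX_exp; exists y.
by rewrite expr1n; apply: in_piX_leq; rewrite leq_pmull.
Qed.

(** Only the kernel of the projection to R / pi^(k+1) is exposed. The exponent is positive so that
    the quotient is a nonzero ring, by [piX_proper]. *)
Lemma piX_quotient k : exists (Q : comNzRingType) (f : {rmorphism R -> Q}),
  forall x, f x = 0 <-> in_piX pi k.+1 x.
Proof.
pose I := [pred x : R | `[< in_piX pi k.+1 x >]].
have hI : idealr_closed I.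
  split; first by apply/asboolP/in_piX0.
    by apply/asboolP/piX_proper.
  move=> a u v /asboolP hu /asboolP hv; apply/asboolP/in_piXD => //.
  exact/in_piXl.
pose Im := isIdealr.Build R I hI.
pose J : idealr R := HB.pack (I : R -> bool) Im.
exists ({ideal_quot J} : comNzRingType), (\pi_{ideal_quot J}%qT) => x.
rewrite -[X in _ = X](rmorph0 (\pi_{ideal_quot J}%qT : {rmorphism R -> _})).
split=> [/eqP|hx].
  by rewrite -Quotient.idealrBE subr0 => /asboolP.
by apply/eqP; rewrite -Quotient.idealrBE subr0; apply/asboolP.
Qed.

Lemma null_seq_comb r f g :
  null_seq pi f -> null_seq pi g -> null_seq pi (fun m => r * f m + g m).
Proof.
move=> hf hg n; have [M hM] := hf n; have [N hN] := hg n.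
exists (maxn M N) => i; rewrite geq_max => /andP[leM leN].
by apply: in_piXD; [apply/in_piXl/hM | exact: hN].
Qed.

Lemma null_seq_piX b : (forall i, in_piX pi i (b i)) -> null_seq pi b.
Proof. by move=> hb n; exists n => i leni; apply: in_piX_leq (hb i). Qed.

(** The bound M does not depend on y, so one truncation computes a series at all points of B. *)
Lemma null_seq_nilp (B : comAlgType R) b : null_seq pi b -> nilp pi B ->
  exists M, forall i, (M <= i)%N -> forall y : B, b i *: y = 0.
Proof.
move=> hb [N hN]; have [M hM] := hb N; exists M => i leMi y.
have [z ->] := hM i leMi; rewrite -scalerA -mulr_algl hN.
by rewrite mul0r.
Qed.

Lemma series_evalE (B : comAlgType R) f : null_seq pi f -> nilp pi B ->
  exists M, forall m, (M <= m)%N -> forall y : B,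
    series_eval f y = \sum_(i < m) f i *: y ^+ i.
Proof.
move=> hf hB; have [M hM] := null_seq_nilp hf hB.
exists M => m leMm y; apply: fin_sumE => i lemi.
by apply: hM; exact: leq_trans lemi.
Qed.

Lemma series_eval_comb (B : comAlgType R) r f g (y : B) :
  null_seq pi f -> null_seq pi g -> nilp pi B ->
  series_eval (fun m => r * f m + g m) y =
    r *: series_eval f y + series_eval g y.
Proof.
move=> hf hg hB; have [M hM] := series_evalE hf hB.
have [N hN] := series_evalE hg hB.
have [L hL] := series_evalE (null_seq_comb r hf hg) hB.
pose m := maxn (maxn M N) L.
have /andP[/andP[leM leN] leL] : [&& (M <= m) && (N <= m) & L <= m]%N.
  by rewrite -geq_max -geq_max.
rewrite (hM m) // (hN m) // (hL m) // scaler_sumr -big_split.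
by apply: eq_bigr => i _; rewrite scalerDl scalerA.
Qed.

(** * Additive series, and rigidity of series commuting with one of them *)

Variable q : nat.
Hypothesis q_gt1 : (1 < q)%N.

Lemma leq_exp_q i : (i <= q ^ i)%N.
Proof. exact/ltnW/ltn_expl. Qed.

Lemma tau_evalE (B : comAlgType R) b : null_seq pi b -> nilp pi B ->
  exists M, forall m, (M <= m)%N -> forall y : B,
    tau_eval q b y = \sum_(i < m) b i *: y ^+ (q ^ i).
Proof.
move=> hb hB; have [M hM] := null_seq_nilp hb hB.
exists M => m leMm y; apply: fin_sumE => i lemi.
by apply: hM; exact: leq_trans lemi.
Qed.

Lemma tau_eval0E (B : comAlgType R) r (y : B) :
  tau_eval q (fun k => (k == 0)%N%:R * r) y = r *: y.
Proof.
rewrite /tau_eval (@fin_sumE _ _ 1) => [|[|i] //]; last by rewrite mul0r scale0r.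
by rewrite big_ord1 mul1r expn0 expr1.
Qed.

(** The element sum b_i tau^i of R{tau}^ seen as an ordinary power series: m is a power of q exactly
    when it equals q^([trunc_log q m]). *)
Definition tau_series (b : nat -> R) m : R :=
  if m == (q ^ trunc_log q m)%N then b (trunc_log q m) else 0.

Lemma tau_seriesX b i : tau_series b (q ^ i)%N = b i.
Proof. by rewrite /tau_series trunc_expnK // eqxx. Qed.

Lemma tau_series_notX b m : (forall i, m != q ^ i)%N -> tau_series b m = 0.
Proof. by move=> /(_ (trunc_log q m)) /negPf h; rewrite /tau_series h. Qed.

Lemma tau_series_null b : null_seq pi b -> null_seq pi (tau_series b).
Proof.
move=> hb n; have [M hM] := hb n; exists (q ^ M)%N => i lei.
rewrite /tau_series; case: ifP => _; last exact: in_piX0.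
by apply: hM; exact: trunc_log_max.
Qed.

Lemma series_eval_tau (B : comAlgType R) b (y : B) :
  null_seq pi b -> nilp pi B -> series_eval (tau_series b) y = tau_eval q b y.
Proof.
move=> hb hB; have [M hM] := tau_evalE hb hB.
have [N hN] := series_evalE (tau_series_null hb) hB.
rewrite (hM (maxn M N)) ?leq_maxl // (hN (q ^ maxn M N)%N); last first.
  by rewrite (leq_trans (leq_maxr M N)) ?leq_exp_q.
elim: (maxn M N) => [|m IH].
  by rewrite expn0 big_ord1 big_ord0 tau_series_notX ?scale0r // => i;
    rewrite eq_sym -lt0n expn_gt0 (ltnW q_gt1).
(* Among the indices i with q^m <= i < q^(m+1), only the first contributes. *)
rewrite big_ord_recr -IH -!(big_mkord xpredT (fun i => tau_series b i *: y ^+ i)).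
rewrite (@big_cat_nat _ _ _ (q ^ m)%N) ?leq_exp2l //=; congr (_ + _).
rewrite big_ltn ?ltn_exp2l // tau_seriesX big_nat_cond big1 ?addr0 // => i.
rewrite andbT => /andP[lt1 lt2].
rewrite /tau_series (@trunc_log_eq _ m) ?(ltnW lt1) //.
by rewrite gtn_eqF ?scale0r.
Qed.

(* Comparing the coefficients of y^m: the leading terms [d_m pi^m] and        *)
(* [pi d_m] differ by the factor [1 - pi^(m-1)], which is regular for m > 1. *)
Lemma series_eq0 d c : null_seq pi d -> null_seq pi c -> c 0%N = pi ->
    d 1%N = 0 ->
    (forall B : comAlgType R, nilp pi B -> forall y : B,
      series_eval d (tau_eval q c y) = pi *: series_eval d y) ->
  forall m, d m = 0.
Proof.
move=> hd hc c0 d1 hdc; elim/ltn_ind => m IH.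
have [->//|m1] := eqVneq m 1%N.
suff hm : pi * d m = d m * pi ^+ m.
  (* For m = 0 the equation reads pi d_0 = d_0; for m >= 2 one factor pi cancels first. *)
  case: m m1 IH hm => [|[//|m]] _ _ hm.
    by apply: (@piX_fixed 1) => //; rewrite expr1 hm mulr1.
  apply: (@piX_fixed m.+1) => //; apply/eqP; rewrite -subr_eq0; apply/eqP/htf.
  by rewrite mulrBr hm [X in X - _]mulrC mulrA -exprS subrr.
apply/eqP; rewrite -subr_eq0; apply/eqP/hcomp.1 => k.
apply: (in_piX_leq (leqnSn k)).
have [Q [f hf]] := piX_quotient k; apply/hf.
(* The test algebra (R / pi^(k+1))[X] turns the functional equation at X into an identity of
   polynomials. *)
pose B : comAlgType R := restr_scalars (polyC \o f : {rmorphism R -> {poly Q}}).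
have scaleE r (x : B) : r *: x = (f r *: (x : {poly Q}) : {poly Q}).
  by rewrite restr_scaleE /= mul_polyC.
have hB : nilp pi B.
  exists k.+1; rewrite scaleE; have /hf -> := in_piXX k.+1.
  by rewrite scale0r.
have [M hM] := series_evalE hd hB; have [N hN] := tau_evalE hc hB.
pose L := maxn M m.+1; have ltmL : (m < L)%N by rewrite leq_maxr.
(* The series c sends X to X u, where u has constant term pi; the bound [N.+1] ensures that the term
   j = 0 is present. *)
pose u : {poly Q} := \sum_(j < N.+1) f (c j) *: 'X^((q ^ j).-1)%N.
have uE : tau_eval q c ('X : B) = ('X * u : {poly Q}).
  rewrite (hN N.+1) // mulr_sumr; apply: eq_bigr => i _.
  rewrite scaleE -scalerAr -exprS.
  by rewrite prednK // expn_gt0 (ltnW q_gt1).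
have dE (x : {poly Q}) :
    series_eval d (x : B) = \sum_(i < L) f (d i) *: x ^+ i :> {poly Q}.
  by rewrite (hM L) ?leq_maxl //; apply: eq_bigr => i _; exact: scaleE.
have h : \sum_(i < L) f (d i) *: ('X * u) ^+ i =
         f pi *: (\sum_(i < L) f (d i) *: 'X^i).
  by rewrite -!dE -uE -scaleE; exact: (hdc B hB ('X : {poly Q})).
have u0 : u`_0 = f pi.
  rewrite coef_sum big_ord_recl big1 => [|i _]; last first.
    rewrite coefZ coefXn lift0 eq_sym -subn1 subn_eq0 leqNgt.
    by rewrite -{1}(expn0 q) ltn_exp2l // mulr0.
  by rewrite coefZ expn0 coefXn mulr1 addr0 c0.
clearbody u L; clear dE uE scaleE hB hM hN; clear B.
move/(congr1 (fun x : {poly Q} => x`_m)): h.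
rewrite coefZ !coef_sum (bigD1 (Ordinal ltmL)) //= [in RHS](bigD1 (Ordinal ltmL)) //=.
(* In the coefficient of X^m, the terms i < m vanish by induction and (X u)^i is divisible by
   X^(m+1) for i > m. *)
rewrite [X in _ + X = _]big1 => [|i ni]; last first.
  rewrite coefZ exprMn coefXnM; case: ltnP => [|leim]; first by rewrite mulr0.
  by rewrite IH ?rmorph0 ?mul0r // ltn_neqAle leim andbT; rewrite -val_eqE in ni.
rewrite [X in _ * (_ + X)]big1 => [|i ni]; last first.
  by move: ni; rewrite coefZ coefXn eq_sym -val_eqE /= => /negPf ->; rewrite mulr0.
rewrite !addr0 !coefZ exprMn coefXnM ltnn subnn coefXn eqxx mulr1.
rewrite -horner_coef0 horner_exp horner_coef0 u0.
by rewrite rmorphB !rmorphM rmorphXn => ->; rewrite subrr.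
Qed.

(** * Composition in R{tau}^ *)

Variable p : nat.
Hypotheses (pR : p \in [pchar R]) (pq : p.-nat q).

Lemma exprDq (B : comAlgType R) (x y : B) i :
  (x + y) ^+ (q ^ i) = x ^+ (q ^ i) + y ^+ (q ^ i).
Proof.
apply: exprDn_pchar; rewrite pnatX; apply/orP; left.
apply: sub_in_pnat pq => r _ /eqP ->.
by rewrite inE (pcharf_prime pR) -scaler_nat (pcharf0 pR) scale0r eqxx.
Qed.

Lemma expr0q (B : comAlgType R) i : (0 : B) ^+ (q ^ i) = 0.
Proof. by rewrite expr0n expn_eq0 gtn_eqF // ltnW. Qed.

Lemma tau_evalD (B : comAlgType R) b (x y : B) : null_seq pi b -> nilp pi B ->
  tau_eval q b (x + y) = tau_eval q b x + tau_eval q b y.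
Proof.
move=> hb hB; have [M hM] := tau_evalE hb hB.
rewrite !(hM M) // -big_split; apply: eq_bigr => i _.
by rewrite exprDq scalerDr.
Qed.

Definition tau_mul (b c : nat -> R) k : R :=
  \sum_(i < k.+1) b i * c (k - i)%N ^+ (q ^ i).

(** For large k, either i is large and b_i is small, or k - i is large and c_(k-i) is small, which
    the power q^i preserves. *)
Lemma tau_mul_null b c : null_seq pi b -> null_seq pi c ->
  null_seq pi (tau_mul b c).
Proof.
move=> hb hc n; have [M hM] := hb n; have [N hN] := hc n.
exists (M + N)%N => k lek; apply: (@in_piX_sum _ _ (fun i => b i * c (k - i)%N ^+ (q ^ i))).
move=> i _; case: (leqP M i) => [/hM/in_piXr //|ltiM].
apply/in_piXl/(@in_piX_leq _ (n * q ^ i)).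
  by rewrite leq_pmulr // expn_gt0 (ltnW q_gt1).
apply/in_piX_exp/hN; rewrite leq_subRL; last first.
  by apply: leq_trans (ltnW ltiM) _; apply: leq_trans lek; apply: leq_addr.
by apply: leq_trans lek; rewrite leq_add2r ltnW.
Qed.

(** The triangle i + j < 2 M contains the square i, j < M, outside which F vanishes. *)
Lemma triangular_sum (C : zmodType) (F : nat -> nat -> C) M :
    (forall i j, (M <= i)%N || (M <= j)%N -> F i j = 0) ->
  \sum_(k < M + M) \sum_(i < k.+1) F i (k - i)%N =
  \sum_(i < M) \sum_(j < M) F i j.
Proof.
move=> F0.
transitivity (\sum_(0 <= i < M + M) \sum_(0 <= k < M + M | (i <= k)%N) F i (k - i)%N).
  rewrite (exchange_big_dep_nat xpredT) //= big_mkord; apply: eq_bigr => k _.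
  rewrite -(big_mkord xpredT (fun i => F i (k - i)%N)).
  rewrite (@big_nat_widen _ _ _ 0 k.+1 (M + M)) //.
rewrite big_mkord; transitivity (\sum_(i < M + M) \sum_(j < M) F i j); last first.
  apply: (@sum_truncate _ (fun i => \sum_(j < M) F i j)); first exact: leq_addr.
  by move=> i leMi; rewrite big1 // => j _; rewrite F0 ?leMi.
apply: eq_bigr => i _; have [leMi|ltiM] := leqP M i.
  by rewrite !big1 // => *; rewrite F0 ?leMi.
transitivity (\sum_(i <= k < M + M) F i (k - i)%N).
  by rewrite (big_nat_widenl i 0).
rewrite -{1}[val i]add0n big_addn.
under eq_bigr do rewrite addnK.
rewrite big_mkord; apply: sum_truncate => [|j leMj]; last by rewrite F0 ?leMj ?orbT.
by rewrite leq_subRL ?leq_add2r 1?ltnW // ltn_addr.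
Qed.

(** The product in R{tau}^ is composition of additive maps, since x -> x^(q^i) is additive in
    characteristic p. *)
Lemma tau_eval_mul (B : comAlgType R) b c (y : B) :
  null_seq pi b -> null_seq pi c -> nilp pi B ->
  tau_eval q (tau_mul b c) y = tau_eval q b (tau_eval q c y).
Proof.
move=> hb hc hB.
have [M1 hM1] := tau_evalE hb hB; have [M2 hM2] := tau_evalE hc hB.
have [M3 hM3] := tau_evalE (tau_mul_null hb hc) hB.
have [N1 hN1] := null_seq_nilp hb hB; have [N2 hN2] := null_seq_nilp hc hB.
pose M := maxn (maxn M1 M2) (maxn M3 (maxn N1 N2)).
have : [&& (M1 <= M)%N, (M2 <= M)%N, (M3 <= M)%N, (N1 <= M)%N & (N2 <= M)%N].
  by rewrite /M !leq_max !leqnn !orbT.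
move=> /and5P[le1 le2 le3 le4 le5].
rewrite (hM1 M) // (hM2 M) // (hM3 (M + M)%N); last exact: leq_trans (leq_addr _ _).
pose F i j : B := b i *: (c j *: y ^+ (q ^ j)) ^+ (q ^ i).
transitivity (\sum_(k < M + M) \sum_(i < k.+1) F i (k - i)%N).
  apply: eq_bigr => k _; rewrite scaler_suml; apply: eq_bigr => i _.
  rewrite /F exprZn scalerA -exprM -expnD subnK //; exact: ltn_ord i.
rewrite triangular_sum => [|i j /orP[leMi|leMj]]; last first.
- by rewrite /F hN2 ?expr0q ?scaler0 // (leq_trans le5).
- by rewrite /F hN1 // (leq_trans le4).
apply: eq_bigr => i _; rewrite /F -scaler_sumr; congr (_ *: _).
pose frob (x : B) := x ^+ (q ^ i).
by rewrite -[RHS]/(frob _) (big_morph frob (fun x z => exprDq x z i) (expr0q B i)).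
Qed.

(** * The recursive solution for t and its inverse *)

Hypothesis q_gt2 : (2 < q)%N.

(** Equality holds for q = 3 and m = 1; for q = 2 the bound fails at m = 1. *)
Lemma leq_addn2_exp_q m : (0 < m)%N -> (m.+2 <= q ^ m)%N.
Proof.
case: m => // m _; elim: m => [|m IH]; first by rewrite expn1.
rewrite expnS; apply: leq_trans (leq_mul q_gt1 IH).
by rewrite mul2n -addnn -addn1 leq_add2l.
Qed.

(* This is where q >= 3 is needed: it gives [(q^m - 1) q^i >= m + 1], which   *)
(* makes [b_k] divisible by [pi^k] after division by [pi - pi^(q^k)]. *)
Lemma tau_log_exists e : e 0%N = pi ->
  exists b : nat -> R, [/\ b 0%N = 1, forall i, in_piX pi i (b i)
    & forall k, tau_mul b (fun i => pi ^+ (q ^ i - 1) * e i) k = pi * b k].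
Proof.
move=> e0; pose c i := pi ^+ (q ^ i - 1) * e i.
(* [l m] is the inverse of 1 - pi^m, with a default value at m = 0. *)
have [m|l hl] := @boolp.choice _ _ (fun m l => (0 < m)%N -> l * (1 - pi ^+ m) = 1).
  by have [->|/one_sub_piX_inv[l hl]] := posnP m; [exists 0 | exists l].
(* [chi k i] is c_(k-i)^(q^i) divided by pi. Thus [G] is the recursion for b_k after cancelling pi
   from pi - pi^(q^k) = pi (1 - pi^(q^k - 1)). *)
pose chi k i := pi ^+ ((q ^ (k - i) - 1) * q ^ i).-1 * e (k - i)%N ^+ (q ^ i).
have expP k i : (i < k)%N -> (k - i < (q ^ (k - i) - 1) * q ^ i)%N.
  rewrite -subn_gt0 => /leq_addn2_exp_q hm.
  rewrite (@leq_trans (q ^ (k - i) - 1)) ?ltn_subRL ?add1n //.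
  by rewrite leq_pmulr // expn_gt0 (ltnW q_gt1).
have chiE k i : (i < k)%N -> c (k - i)%N ^+ (q ^ i) = pi * chi k i.
  move=> /expP hm; rewrite /c /chi exprMn -exprM mulrA -exprS prednK //.
  exact: leq_ltn_trans hm.
pose G k b := if k is 0 then 1 else l (q ^ k - 1)%N * \sum_(i < k) b i * chi k i.
have [|b hb] := @strong_rec _ (0 : R) G.
  case=> // k f g hfg; rewrite /G; congr (_ * _); apply: eq_bigr => i _.
  by rewrite hfg.
exists b; split; first by rewrite hb.
  elim/ltn_ind => k IH; rewrite hb /G; case: k IH => [|k] IH; first by exists 1; rewrite mulr1.
  apply/in_piXl/(@in_piX_sum _ _ (fun i => b i * chi k.+1 i)) => i ltik.
  rewrite -(subnKC (ltnW ltik)); apply/in_piXM; first exact: IH.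
  rewrite subnKC ?(ltnW ltik) //; apply/in_piXr/in_piX_leq/in_piXX.
  by have := expP _ _ ltik; case: (_ * _)%N.
move=> k; rewrite /tau_mul big_ord_recr /= -/(c (k - k)%N) subnn.
have -> : c 0%N = pi by rewrite /c expn0 expr0 mul1r.
case: k => [|k]; first by rewrite big_ord0 add0r expn0 expr1 mulrC.
under eq_bigr => i _ do rewrite -/(c _) chiE // mulrCA.
rewrite -mulr_sumr; set S := \sum_(i < _) _.
have bE : b k.+1 = l (q ^ k.+1 - 1)%N * S by rewrite hb.
have q1 : (0 < q ^ k.+1 - 1)%N by rewrite subn_gt0 -(expn0 q) ltn_exp2l.
have -> : S = b k.+1 * (1 - pi ^+ (q ^ k.+1 - 1)).
  by rewrite bE mulrAC hl // mul1r.
have -> : pi ^+ (q ^ k.+1) = pi * pi ^+ (q ^ k.+1 - 1).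
  by rewrite -exprS subn1 prednK // expn_gt0 (ltnW q_gt1).
by rewrite [b _ * (pi * _)]mulrCA -mulrDr mulrBr mulr1 subrK.
Qed.

(** The equation in degree k has g_k with coefficient b_0^(q^k) = 1, so it is solved recursively;
    divisibility by pi^k is inherited from b. *)
Lemma tau_left_inverse b : b 0%N = 1 -> (forall i, in_piX pi i (b i)) ->
  exists g : nat -> R, [/\ g 0%N = 1, forall i, in_piX pi i (g i)
    & forall k, tau_mul g b k = (k == 0)%N%:R].
Proof.
move=> b0 hb.
pose G k g := if k is 0 then 1 else - \sum_(i < k) g i * b (k - i)%N ^+ (q ^ i).
have [|g hg] := @strong_rec _ (0 : R) G.
  case=> // k f g hfg; rewrite /G; congr (- _); apply: eq_bigr => i _.
  by rewrite hfg.
exists g; split; first by rewrite hg.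
  elim/ltn_ind => k IH; rewrite hg /G; case: k IH => [|k] IH; first by exists 1; rewrite mulr1.
  rewrite -mulN1r; apply/in_piXl/(@in_piX_sum _ _ (fun i => g i * b (k.+1 - i)%N ^+ (q ^ i))).
  move=> i ltik; rewrite -(subnKC (ltnW ltik)); apply/in_piXM; first exact: IH.
  rewrite subnKC ?(ltnW ltik) //.
  apply: (@in_piX_leq _ ((k.+1 - i) * q ^ i)); last exact: in_piX_exp.
  by rewrite leq_pmulr // expn_gt0 (ltnW q_gt1).
move=> k; rewrite /tau_mul big_ord_recr /= subnn b0 expr1n mulr1.
by case: k => [|k]; [rewrite big_ord0 add0r hg | rewrite hg addrN].
Qed.

Lemma eq_tau_eval (B : comAlgType R) b c (y : B) :
  b =1 c -> tau_eval q b y = tau_eval q c y.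
Proof. by move=> /funext ->. Qed.

Lemma tau_inverse b : b 0%N = 1 -> (forall i, in_piX pi i (b i)) ->
  exists2 g : nat -> R, forall i, in_piX pi i (g i)
    & forall B : comAlgType R, nilp pi B -> forall y : B,
        tau_eval q g (tau_eval q b y) = y /\ tau_eval q b (tau_eval q g y) = y.
Proof.
have leftP b' : b' 0%N = 1 -> (forall i, in_piX pi i (b' i)) ->
    exists g : nat -> R, [/\ g 0%N = 1, forall i, in_piX pi i (g i)
    & forall B : comAlgType R, nilp pi B -> forall y : B,
        tau_eval q g (tau_eval q b' y) = y].
  move=> b0 hb; have [g [g0 hg gb]] := tau_left_inverse b0 hb.
  exists g; split=> // B hB y.
  rewrite -tau_eval_mul //; [|exact: null_seq_piX ..].
  rewrite (@eq_tau_eval _ _ (fun k => (k == 0)%N%:R * 1)); last first.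
    by move=> k; rewrite gb mulr1.
  by rewrite tau_eval0E scale1r.
move=> b0 hb; have [g [g0 hg gb]] := leftP _ b0 hb.
have [h [_ hh hg1]] := leftP _ g0 hg.
exists g => // B hB y; split; first exact: gb.
(* If h g = 1 and g b = 1, then b g = h (g b) g = h g = 1. *)
by rewrite -[RHS](hg1 B hB) -{1}(hg1 B hB (tau_eval q b _)) gb.
Qed.

(** * From commutation with t to linearity over A *)

Variables (A : comNzRingType) (theta : A -> R) (psi : A -> nat -> R) (t : A).
Hypotheses (psi_null : forall a, null_seq pi (psi a))
  (psi0 : forall a, psi a 0%N = theta a)
  (psiM : forall a b, psi (a * b) =1 tau_mul (psi a) (psi b))
  (theta_t : theta t = pi).

(* A series commuting with the action of t is determined by its linear        *)
(* coefficient. *)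
Lemma t_linear_unique f g : null_seq pi f -> null_seq pi g -> f 1%N = g 1%N ->
    (forall B : comAlgType R, nilp pi B -> forall y : B,
      series_eval f (tau_eval q (psi t) y) = pi *: series_eval f y) ->
    (forall B : comAlgType R, nilp pi B -> forall y : B,
      series_eval g (tau_eval q (psi t) y) = pi *: series_eval g y) ->
  f =1 g.
Proof.
move=> hf hg fg1 hft hgt m; apply/esym/eqP; rewrite -subr_eq0 -mulN1r addrC.
apply/eqP; move: m; apply: (series_eq0 _ (psi_null t)).
- exact: null_seq_comb.
- by rewrite psi0.
- by rewrite fg1 mulN1r addNr.
- move=> B hB y; rewrite !series_eval_comb // hft // hgt //.
  by rewrite scalerDr !scalerA mulrC.
Qed.

(* [b psi(a)] commutes with the action of t because A is commutative, and has *)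
(* linear coefficient [theta a]. *)
Lemma tau_log_linear b : b 0%N = 1 -> null_seq pi b ->
    (forall k, tau_mul b (psi t) k = pi * b k) ->
  forall (B : comAlgType R), nilp pi B -> forall a (y : B),
    tau_eval q b (tau_eval q (psi a) y) = theta a *: tau_eval q b y.
Proof.
move=> b0 hb hbt.
have hbtE (B : comAlgType R) (y : B) : nilp pi B ->
    tau_eval q b (tau_eval q (psi t) y) = pi *: tau_eval q b y.
  move=> hB; rewrite -tau_eval_mul // (eq_tau_eval _ hbt).
  have [M hM] := tau_evalE hb hB; have [L hL] := tau_evalE (tau_mul_null hb (psi_null t)) hB.
  rewrite -(eq_tau_eval _ hbt) (hL (maxn M L)) ?leq_maxr // (hM (maxn M L)) ?leq_maxl //.
  by rewrite scaler_sumr; apply: eq_bigr => i _; rewrite hbt scalerA.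
have psiC (B : comAlgType R) a (y : B) : nilp pi B ->
    tau_eval q (psi a) (tau_eval q (psi t) y) =
    tau_eval q (psi t) (tau_eval q (psi a) y).
  move=> hB; rewrite -!tau_eval_mul //; apply: eq_tau_eval => k.
  by rewrite -!psiM mulrC.
move=> B hB a y; have hba := tau_mul_null hb (psi_null a).
have hs0 : null_seq pi (fun=> 0 : R) by move=> n; exists 0%N => i _; exact: in_piX0.
have hts := tau_series_null hb.
(* The summand 0 gives the scalar multiple the shape r f + g handled by [series_eval_comb]. *)
have serE (C : comAlgType R) (z : C) : nilp pi C ->
    series_eval (fun m => theta a * tau_series b m + 0) z = theta a *: tau_eval q b z.
  move=> hC; rewrite series_eval_comb // series_eval_tau //.
  by rewrite [series_eval _ _](@fin_sumE _ _ 0) ?big_ord0 ?addr0 // => i _; rewrite scale0r.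
rewrite -serE // -tau_eval_mul // -series_eval_tau //.
congr (series_eval _ y); apply/funext/t_linear_unique.
- exact: tau_series_null.
- exact: null_seq_comb.
- by rewrite addr0 -(expn0 q) !tau_seriesX /tau_mul big_ord1 b0 psi0 mul1r mulr1 expn0 expr1.
- move=> C hC z; rewrite !series_eval_tau // !tau_eval_mul //.
  by rewrite psiC // hbtE.
- by move=> C hC z; rewrite !serE // hbtE // scalerA mulrC scalerA.
Qed.

End Adic.

(** * The A-module structure of the jet kernel and its homomorphisms *)

Lemma iter_rmorphism (R : comNzRingType) (phi : {rmorphism R -> R}) m :
  exists g : {rmorphism R -> R}, forall x, iter m phi x = g x.
Proof.
elim: m => [|m [g hg]]; first by exists idfun.
by exists (phi \o g) => x; rewrite iterS hg.
Qed.

Section JetKernel.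
Variables (A R : comNzRingType) (pi : R) (theta : A -> R).
Variables (qh : nat) (phi : {rmorphism R -> R}).
Hypotheses (hcomp : adically_complete pi) (htf : torsion_free pi).
Hypotheses (hqh : (0 < qh)%N) (phi_pi : phi pi = pi).
Hypothesis phi_theta : forall a, phi (theta a) = theta a.
Variables (q p : nat).
Hypotheses (q_gt2 : (2 < q)%N) (pR : p \in [pchar R]) (pq : p.-nat q).
Variables (W : wittFunctor pi qh phi) (E : admissible q pi theta) (n : nat).
Variables (t : A).
Hypothesis theta_t : theta t = pi.

Let q_gt1 : (1 < q)%N := ltnW q_gt2.

(* [r V(y) = V(phi^(n+1)(r) y)] and [V(y) V(z) = V(pi^(n+1) y z)] for the    *)
(* vector [V(y) = (0, ..., 0, y)] turn the series of [E a] into this one on y. *)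
Definition ker_coef a i : R := iter n.+1 phi (E a i) * pi ^+ (n.+1 * (q ^ i - 1)).

Lemma ker_coef_null a : null_seq pi (ker_coef a).
Proof.
have [g hg] := iter_rmorphism phi n.+1.
have g_pi : g pi = pi.
  by rewrite -hg; elim: n.+1 => //= m ->.
move=> k; have [M hM] := adm_null E a k; exists M => i /hM [x hx].
by apply: in_piXr; rewrite hg hx rmorphM rmorphXn g_pi; exists (g x).
Qed.

Lemma ker_coef0 a : ker_coef a 0 = theta a.
Proof.
rewrite /ker_coef subnn muln0 mulr1 adm_tau0.
by elim: n.+1 => //= m ->.
Qed.

(** Applying phi^(n+1) to coefficients and conjugating by pi^(n+1) both respect products. The
    exponents match because (q^i - 1) + (q^(k-i) - 1) q^i = q^k - 1. *)
Lemma ker_coefM a b : ker_coef (a * b) =1 tau_mul q (ker_coef a) (ker_coef b).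
Proof.
move=> k; have [g hg] := iter_rmorphism phi n.+1.
rewrite /ker_coef adm_mul hg rmorph_sum mulr_suml; apply: eq_bigr => i _.
rewrite !hg rmorphM rmorphXn exprMn mulrACA; congr (_ * _).
rewrite -exprM -exprD -mulnA -mulnDr mulnBl -expnD subnK ?mul1n; last exact: ltn_ord i.
by rewrite addnC addnBA ?subnK ?expn_gt0 ?(ltnW q_gt1) ?leq_exp2l //; exact: ltn_ord i.
Qed.

Lemma jet_act_ver (B : comAlgType R) a (y : B) : nilp pi B ->
  jet_act E a (ver W n y) = ver W n (tau_eval q (ker_coef a) y).
Proof.
move=> hB; have [M hM] := tau_evalE q (ker_coef_null a) hB.
have [N hN] := null_seq_nilp (ker_coef_null a) hB.
have termE i : E a i *: ver W n y ^+ (q ^ i) = ver W n (ker_coef a i *: y ^+ (q ^ i)).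
  have qi : (0 < q ^ i)%N by rewrite expn_gt0 (ltnW q_gt1).
  by rewrite /ker_coef subn1 -{1}(prednK qi) ver_exp // ver_scale // scalerA prednK.
rewrite /jet_act /tau_eval (@fin_sumE _ _ (maxn M N)); last first.
  by move=> i; rewrite geq_max => /andP[_ /hN hi]; rewrite termE hi ver0.
rewrite -/(tau_eval q (ker_coef a) y) (hM (maxn M N)) ?leq_maxl //.
rewrite (big_morph (@ver _ _ _ _ W n B)
  (fun x z => esym (ver_add htf hqh W n x z)) (ver0 htf hqh W n B)).
by apply: eq_bigr => i _; exact: termE.
Qed.

Let H := jet_ker W E n.
Let G := Ga theta.

Let HP (B : comAlgType R) (x : witt W n.+1 B) :
  jet_proj x = 0 <-> x = ver W n (coord x ord_max).
Proof. exact: jet_ker_pts. Qed.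

(** The points of H are exactly the V(y), on which addition and action are explicit; Hom_A thus
    becomes a pair of functional equations in y. *)
Lemma homA_ker_Ga f : homA pi H G f <-> null_seq pi f /\
  forall B : comAlgType R, nilp pi B ->
    (forall y z : B, series_eval f (y + z) = series_eval f y + series_eval f z) /\
    (forall a (y : B),
       series_eval f (tau_eval q (ker_coef a) y) = theta a *: series_eval f y).
Proof.
have verP (B : comAlgType R) (y : B) : jet_proj (ver W n y) = 0.
  by apply/HP; rewrite coord_ver_max.
have mapP (B : comAlgType R) (y : B) :
    maps_to (M := H) (N := G) f (ver W n y) (series_eval f y).
  by split=> //=; rewrite coord_ver_max.
split=> -[hf hB]; split=> // B /[dup] nB /hB [hD hZ]; split.
- move=> y z; have [_ _ /=] := hD _ _ _ _ (mapP B y) (mapP B z).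
  by rewrite ver_add // coord_ver_max.
- move=> a y; have [_ _ /=] := hZ a _ _ (mapP B y).
  by rewrite jet_act_ver // coord_ver_max.
- move=> x x' z z' [/= /HP -> _ ->] [/= /HP -> _ ->].
  rewrite !coord_ver_max ver_add //; split=> //=.
  by rewrite coord_ver_max hD.
- move=> a x z [/= /HP -> _ ->]; rewrite jet_act_ver // coord_ver_max.
  by split=> //=; rewrite coord_ver_max hZ.
Qed.

Lemma homA_Ga_ker g : null_seq pi g ->
    (forall B : comAlgType R, nilp pi B ->
      (forall y z : B,
         series_eval g (y + z) = series_eval g y + series_eval g z) /\
      (forall a (y : B),
         series_eval g (theta a *: y) = tau_eval q (ker_coef a) (series_eval g y))) ->
  homA pi G H g.
Proof.
have verP (B : comAlgType R) (y : B) : jet_proj (ver W n y) = 0.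
  by apply/HP; rewrite coord_ver_max.
move=> hg hB; split=> // B /[dup] nB /hB [hD hZ]; split.
- move=> x x' z z' [_ /= /HP zE e] [_ /= /HP zE' e']; rewrite zE zE' e e'.
  by rewrite ver_add //; split=> //=; rewrite coord_ver_max hD.
- move=> a x z [_ /= /HP zE e]; rewrite zE e jet_act_ver //.
  by split=> //=; rewrite coord_ver_max hZ.
Qed.

Lemma homA_ker_Ga_unique f g :
  homA pi H G f -> homA pi H G g -> f 1%N = g 1%N -> f =1 g.
Proof.
move=> /homA_ker_Ga [hf hfB] /homA_ker_Ga [hg hgB] fg1.
apply: (t_linear_unique hcomp htf q_gt1 ker_coef_null ker_coef0 theta_t) => //.
  by move=> B hB y; rewrite (hfB B hB).2 theta_t.
by move=> B hB y; rewrite (hgB B hB).2 theta_t.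
Qed.

Lemma homA_ker_Ga_comb r f g : homA pi H G f -> homA pi H G g ->
  homA pi H G (fun m => r * f m + g m).
Proof.
move=> /homA_ker_Ga [hf hfB] /homA_ker_Ga [hg hgB].
apply/homA_ker_Ga; split; first exact: null_seq_comb.
move=> B hB; have [fD fZ] := hfB B hB; have [gD gZ] := hgB B hB.
split=> [y z | a y]; rewrite !(@series_eval_comb _ pi) //.
  by rewrite fD gD scalerDr addrACA.
by rewrite fZ gZ scalerDr !scalerA mulrC.
Qed.

Lemma homA_ker_Ga0 : homA pi H G (fun=> 0).
Proof.
apply/homA_ker_Ga; split; first by move=> k; exists 0%N => i _; exact: in_piX0.
have ev0 (B : comAlgType R) (y : B) : series_eval (fun=> 0) y = 0.
  rewrite /series_eval (@fin_sumE _ _ 0) ?big_ord0 // => i _.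
  by rewrite scale0r.
by move=> B hB; split=> *; rewrite !ev0 ?addr0 ?scaler0.
Qed.

Lemma theta_form_iso_exists :
  exists v : nat -> R, theta_form q pi v /\ isoA pi H G v.
Proof.
(* One factor pi^(q^i - 1) of psi(t)_i is split off, as [tau_log_exists] requires; there is one
   because n + 1 >= 1. *)
pose e i := iter n.+1 phi (E t i) * pi ^+ (n * (q ^ i - 1)).
have e0 : e 0%N = pi.
  by have := ker_coef0 t; rewrite /ker_coef /e subnn !muln0 theta_t.
have [b [b0 hb hbt]] := tau_log_exists hcomp q_gt1 q_gt2 e0.
have hbt' k : tau_mul q b (ker_coef t) k = pi * b k.
  rewrite -hbt; apply: eq_bigr => i _; congr (_ * _ ^+ _).
  by rewrite /ker_coef /e mulrCA -exprD mulSn.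
have [g hg bg] := tau_inverse q_gt1 pR pq b0 hb.
have nb := null_seq_piX hb; have ng := null_seq_piX hg.
have bZ := tau_log_linear hcomp htf q_gt1 pR pq ker_coef_null ker_coef0
  ker_coefM theta_t b0 nb hbt'.
exists (tau_series q b); split.
  exists b; split=> // [i|m]; [exact: tau_seriesX | exact: tau_series_notX].
have nbs := tau_series_null q_gt1 nb; have ngs := tau_series_null q_gt1 ng.
split.
  apply/homA_ker_Ga; split=> // B hB; split=> [y z | a y].
    by rewrite !(@series_eval_tau _ pi) // (@tau_evalD _ pi _ _ pR pq).
  by rewrite !(@series_eval_tau _ pi) // bZ.
exists (tau_series q g) => [|B hB y]; last by rewrite !(@series_eval_tau _ pi) //; exact: bg.
apply: homA_Ga_ker => // B hB; split=> [y z | a y].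
  by rewrite !(@series_eval_tau _ pi) // (@tau_evalD _ pi _ _ pR pq).
(* With y = b(g(y)), linearity of b gives g(theta(a) y) = g(b(psi(a)(g(y)))) = psi(a)(g(y)). *)
rewrite !(@series_eval_tau _ pi) // -{1}((bg B hB y).2) -bZ //.
exact: (bg B hB _).1.
Qed.

Theorem hom_jet_ker_Ga : exists v : nat -> R,
  [/\ theta_form q pi v /\ isoA pi H G v,
      forall f : nat -> R,
        theta_form q pi f -> isoA pi H G f -> forall m, f m = v m
    & free_with_basis (homA pi H G) v].
Proof.
have [v [vform viso]] := theta_form_iso_exists.
have form1 f : theta_form q pi f -> f 1%N = 1.
  by case=> b [b0 _ fb _]; rewrite -(expn0 q) fb.
exists v; split=> // [f fform fiso|].
  by apply: homA_ker_Ga_unique; rewrite ?form1 //; [exact: fiso.1 | exact: viso.1].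
split; [exact: homA_ker_Ga0 | exact: homA_ker_Ga_comb | exact: viso.1 |].
(* The scalar is read off from the linear coefficients, that of v being 1. *)
move=> f hf; exists (f 1%N); split=> [m | r ->]; last by rewrite form1 ?mulr1.
have hv := homA_ker_Ga_comb (f 1%N) viso.1 homA_ker_Ga0.
by rewrite (homA_ker_Ga_unique hf hv) /= addr0 // (form1 v) // mulr1.
Qed.

End JetKernel.

(** * The characteristic, and the case of the curve *)

Lemma finField_card_pnat (F : finFieldType) :
  exists2 p : nat, p \in [pchar F] & p.-nat #|F|.
Proof.
have [p _ pF] := finPcharP F; exists p => //; rewrite -cardsT.
exact/abelem_pgroup/fin_ring_pchar_abelem.
Qed.

Theorem theorem6p2
  (F : finFieldType) (hq : (3 <= #|F|)%N)
  (K : fieldType) (iota : {rmorphism F -> K}) (hK : function_field iota)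
  (infty : K -> Prop) (hinfty : rational_place iota infty)
  (A : comNzRingType) (j : {rmorphism A -> K})
  (hA : regular_outside iota infty j)
  (P : {pred A}) (hP : maximal_ideal P)
  (qh : nat) (hqh : quotient_card P qh)
  (t : A) (ht : t \in P) (ht2 : ~ ideal_exp P 2 t)
  (Ahat : comNzRingType) (c : {rmorphism A -> Ahat})
  (hc : adic_completion P c)
  (R : comAlgType Ahat)
  (hcomplete : adically_complete (struct_map c R t))
  (htf : torsion_free (struct_map c R t))
  (phi : {lrmorphism R -> R})
  (hphi : forall x : R, in_piX (struct_map c R t) 1 (phi x - x ^+ qh))
  (W : wittFunctor (struct_map c R t) qh phi)
  (E : admissible #|F| (struct_map c R t) (struct_map c R))
  (n : nat) :
  let pi := struct_map c R t in
  let H := jet_ker W E n (* H^(n+1) *) in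
  let G := Ga (struct_map c R) in
  exists vartheta : nat -> R,
  [/\ theta_form #|F| pi vartheta /\ isoA pi H G vartheta,
      forall f : nat -> R,
        theta_form #|F| pi f -> isoA pi H G f -> forall m, f m = vartheta m
    & free_with_basis (homA pi H G) vartheta].
Proof.
move=> pi H G.
have qh_gt0 : (0 < qh)%N.
  by case: hqh => f _; apply: leq_ltn_trans (ltn_ord (f 0)).
(* phi is linear over the completion, so it fixes the image of A, in particular pi. *)
have phiC a : phi (struct_map c R a) = struct_map c R a.
  by rewrite /struct_map linearZ /= rmorph1.
have [p pF pq] := finField_card_pnat F.
have pR : p \in [pchar R].
  rewrite inE (pcharf_prime pF); apply/eqP.
  (* A embeds in K, an extension of F, so p = 0 in A, hence in its completion and in R. *)
  have pA : p%:R = 0 :> A.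
    apply: hA.1; rewrite rmorph_nat rmorph0 -(rmorph_nat iota) (pcharf0 pF).
    exact: rmorph0.
  by rewrite -scaler_nat -[p%:R](rmorph_nat c) pA rmorph0 scale0r.
exact: (@hom_jet_ker_Ga A R pi (struct_map c R) qh phi hcomplete htf qh_gt0
  (phiC t) phiC _ p hq pR pq W E n t erefl).
Qed.
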